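(* Let $\mathcal{H}$ be a finite-dimensional vector space over some field $\mathbb{F}$. Let $G\subset\mathrm{GL}(\mathcal{H})$ be a Zariski-connected subgroup whose action on $\mathcal{H}$ is irreducible. Let $V,W\subseteq\mathcal{H}$ be subspaces, and denote by $\mathcal{L}_V,\mathcal{L}_W$ the $G$-invariant sublattices of $\mathrm{Gr}(\mathcal{H})$ generated by $V$ and $W$ respectively. Assume that $$\min_{g\in G}\dim(gV\cap W)=\frac{\dim V\,\dim W}{\dim\mathcal{H}}.$$ Then for every $V'\in\mathcal{L}_V$ and $W'\in\mathcal{L}_W$, one has $$\dim(V'\cap W')=\frac{\dim V'\,\dim W'}{\dim\mathcal{H}}.$$ Moreover, $\mathcal{L}_W$ is complemented, and given any splitting $\mathcal{H}=W'\oplus W''$ with $W',W''\in\mathcal{L}_W$, one has for all $V'\in\mathcal{L}_V$, $$V'=(V'\cap W')\oplus(V'\cap W'').$$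
   Context: The field $\mathbb{F}$ is arbitrary; $G$ is not assumed Zariski-closed; Zariski-connected means connected for the topology induced by the Zariski topology on $\mathrm{GL}(\mathcal{H})$. $\mathrm{Gr}(\mathcal{H})$ is the set of all linear subspaces of $\mathcal{H}$. A sublattice of $\mathrm{Gr}(\mathcal{H})$ is a collection $\mathcal{L}$ of subspaces of $\mathcal{H}$ which is stable under sum and intersection and contains both $\{0\}$ and $\mathcal{H}$. It is $G$-invariant if $gU\in\mathcal{L}$ for all $g\in G$, $U\in\mathcal{L}$. It is complemented if for every $U\in\mathcal{L}$ there is $U'\in\mathcal{L}$ with $\mathcal{H}=U\oplus U'$. The $G$-invariant sublattice generated by $V$ is the smallest $G$-invariant sublattice containing $V$. *)

(* Defs.v *)
From HB Require Import structures.
From mathcomp Require Import all_boot all_algebra.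
From mathcomp Require Import mpoly.
From mathcomp Require Import boolp classical_sets topology_structure connected.

Set Implicit Arguments.
Unset Strict Implicit.
Unset Printing Implicit Defensive.

Import GRing.Theory.
Local Open Scope classical_set_scope.
Local Open Scope ring_scope.

(* A copy of the vector space E that carries the Zariski topology; the          *)
(* topology does not depend on the basis used for the coordinates.              *)
Definition zariski (F : fieldType) (E : vectType F) : Type := E.

Section ZariskiTopology.
Variables (F : fieldType) (E : vectType F).

HB.instance Definition _ := Choice.on (zariski E).

Definition peval (p : {mpoly F[\dim {:E}]}) (x : E) : F :=
  p.@[fun i => coord (vbasis {:E}) i x].

Definition zero_locus (S : set {mpoly F[\dim {:E}]}) : set (zariski E) :=
  [set x | forall p, S p -> peval p x = 0].

Definition zariski_open (A : set (zariski E)) : Prop :=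
  exists S, ~` A = zero_locus S.

Lemma zariski_openT : zariski_open setT.
Proof.
exists [set 1]; rewrite setCT; apply/seteqP; split=> // x /(_ 1 erefl) /eqP.
by rewrite /peval meval1 oner_eq0.
Qed.

Lemma zariski_openI : setI_closed zariski_open.
Proof.
move=> A B [S AS] [T BT].
exists [set r | exists p q, [/\ S p, T q & r = p * q]].
rewrite setCI AS BT; apply/seteqP; split=> [x SxTx _ [p [q [Sp Tq ->]]]|x STx].
  rewrite /peval mevalM -!/(peval _ _).
  by case: SxTx => [/(_ _ Sp)|/(_ _ Tq)] ->; rewrite ?mul0r ?mulr0.
apply: contrapT => /not_orP[/existsNP[p /not_implyP[Sp px]]].
move=> /existsNP[q /not_implyP[Tq qx]].
have /eqP : peval (p * q) x = 0 by apply: STx; exists p, q.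
by rewrite /peval mevalM mulf_eq0 => /orP[] /eqP.
Qed.

Lemma zariski_open_bigU (I : Type) (f : I -> set (zariski E)) :
  (forall i, zariski_open (f i)) -> zariski_open (\bigcup_i f i).
Proof.
move=> fo; exists [set p | exists i, forall x, ~ f i x -> peval p x = 0].
apply/seteqP; split=> [x nfx p [i]|x px [i _ fix_]].
  by apply=> fix_; apply: nfx; exists i.
have [S fiS] := fo i.
suff : (~` f i) x by [].
rewrite fiS => p Sp; apply: px; exists i => y nfy.
by have : (~` f i) y by []; rewrite fiS; apply.
Qed.

HB.instance Definition _ := isOpenTopological.Build (zariski E)
  zariski_openT zariski_openI zariski_open_bigU.

Lemma zariski_closedE (A : set (zariski E)) :
  closed A <-> exists S, A = zero_locus S.
Proof. by rewrite -openC; split=> -[S AS]; exists S; move: AS; rewrite setCK. Qed.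

End ZariskiTopology.

Section Groups.
Variables (F : fieldType) (vT : vectType F).

(* In finite dimension the invertible endomorphisms are the injective ones; on  *)
(* these g^-1%VF is the two-sided inverse.                                      *)
Definition GL : set 'End(vT) := [set g | lker g == 0%VS].

Definition GL_subgroup (G : set 'End(vT)) : Prop :=
  [/\ G `<=` GL,
      G \1%VF,
      forall g h, G g -> G h -> G (g \o h)%VF
    & forall g, G g -> G (g^-1)%VF].

(* GL is the open subset det != 0 of the affine space 'End(vT), and the Zariski *)
(* topology of GL is the one induced from 'End(vT) (denominators det ^+ k can   *)
(* be cleared in equations).  Connectedness of G only depends on the topology   *)
(* induced on G, so it can be tested in 'End(vT).                               *)
Definition zariski_connected (G : set 'End(vT)) : Prop :=
  connected (G : set (zariski 'End(vT))).

Definition acts_irreducibly_on (G : set 'End(vT)) : Prop :=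
  {:vT}%VS != 0%VS /\
  forall U : {vspace vT}, (forall g, G g -> (g @: U <= U)%VS) ->
    U = 0%VS \/ U = {:vT}%VS.

End Groups.

Section Lattices.
Variables (F : fieldType) (vT : vectType F).

Definition is_sublattice (L : set {vspace vT}) : Prop :=
  [/\ L 0%VS, L {:vT}%VS,
      forall U U', L U -> L U' -> L (U + U')%VS
    & forall U U', L U -> L U' -> L (U :&: U')%VS].

Definition is_invariant (G : set 'End(vT)) (L : set {vspace vT}) : Prop :=
  forall g U, G g -> L U -> L (g @: U)%VS.

Definition inv_sublattice_gen (G : set 'End(vT)) (V : {vspace vT}) :
    set {vspace vT} :=
  smallest [set L | is_sublattice L /\ is_invariant G L] [set V].

Definition is_dsum (U U1 U2 : {vspace vT}) : Prop :=
  U = (U1 + U2)%VS /\ directv (U1 + U2).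

Definition complemented (L : set {vspace vT}) : Prop :=
  forall U, L U -> exists2 U', L U' & is_dsum {:vT} U U'.

End Lattices.

Definition is_min (A : set nat) (m : nat) : Prop :=
  A m /\ forall k, A k -> (m <= k)%N.

(* Main.v *)
(* Write phi(U) for the generic (minimal) dimension of gV :&: U, g in G, and n
   for the dimension of the ambient space.  Two generic conditions on g can be
   met simultaneously, so phi is supermodular, and so is
   phi(U) - dim V * dim U / n.  The largest maximizer of the latter is
   G-invariant, hence trivial, so the maximum is 0 and the maximizers form a
   G-invariant sublattice; thus equality propagates from V, W to L_V, L_W.
   For a splitting W' + W'' in L_W, the lower bounds on dim (V' :&: W') and
   dim (V' :&: W'') by their generic values add up to dim V'.

   Generic conditions are compatible because a form of degree d vanishing on a
   nonempty open subset of G vanishes on G: the space of d-forms vanishing near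
   x in G increases locally, and near a point where its (finite) dimension is
   maximal it is constant; by homogeneity it is locally constant, so it is
   constant on G by connectedness. *)

From HB Require Import structures.
Require Import Defs.
From mathcomp Require Import all_boot all_algebra all_fingroup.
From mathcomp Require Import mpoly zify.
From mathcomp Require Import boolp classical_sets topology_structure connected.
Set Implicit Arguments.
Unset Strict Implicit.
Unset Printing Implicit Defensive.
Import GRing.Theory Num.Theory.
Local Open Scope classical_set_scope.
Local Open Scope ring_scope.

(** * Polynomial functions and homogeneous forms on a vector space *)

Section PolynomialFunctions.
Variables (F : fieldType) (E : vectType F).
Implicit Types f : E -> F.
Local Notation N := (\dim {:E}).
Local Notation xi := (coord (vbasis {:E})).

Definition polyfun f := exists p, f = peval p.

Lemma polyfun_cst a : polyfun (fun=> a).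
Proof. by exists a%:MP; apply/funext => x; rewrite /peval mevalC. Qed.

Lemma polyfun_coord i : polyfun (xi i).
Proof. by exists 'X_i; apply/funext => x; rewrite /peval mevalXU. Qed.

Lemma polyfunD f1 f2 :
  polyfun f1 -> polyfun f2 -> polyfun (fun x => f1 x + f2 x).
Proof.
move=> [p ->] [q ->]; exists (p + q).
by apply/funext => x; rewrite /peval mevalD.
Qed.

Lemma polyfunM f1 f2 :
  polyfun f1 -> polyfun f2 -> polyfun (fun x => f1 x * f2 x).
Proof.
move=> [p ->] [q ->]; exists (p * q).
by apply/funext => x; rewrite /peval mevalM.
Qed.

Lemma polyfun_sum (I : Type) (r : seq I) (P : pred I) (f : I -> E -> F) :
  (forall i, polyfun (f i)) -> polyfun (fun x => \sum_(i <- r | P i) f i x).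
Proof.
move=> pf; elim: r => [|i r IHr].
  by under eq_fun do rewrite big_nil; apply: polyfun_cst.
under eq_fun do rewrite big_cons.
by case: (P i) => //; apply: polyfunD.
Qed.

Lemma polyfun_prod (I : Type) (r : seq I) (P : pred I) (f : I -> E -> F) :
  (forall i, polyfun (f i)) -> polyfun (fun x => \prod_(i <- r | P i) f i x).
Proof.
move=> pf; elim: r => [|i r IHr].
  by under eq_fun do rewrite big_nil; apply: polyfun_cst.
under eq_fun do rewrite big_cons.
by case: (P i) => //; apply: polyfunM.
Qed.

Lemma polyfun_linear (l : {linear E -> F^o}) : polyfun l.
Proof.
have -> : l = (fun x => \sum_i xi i x * l (vbasis {:E})`_i) :> (E -> F).
  apply/funext => x; rewrite {1}(coord_vbasis (memvf x)) linear_sum.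
  by apply: eq_bigr => i _; rewrite linearZ.
by apply: polyfun_sum => i; apply: polyfunM (polyfun_coord i) (polyfun_cst _).
Qed.

(** The coordinates of [h x] are linear functionals of x, so a monomial expansion of the polynomial
    suffices. This pulls principal open sets back along translations. *)
Lemma polyfun_comp (h : {linear E -> E}) f : polyfun f -> polyfun (f \o h).
Proof.
move=> [p ->].
have -> : peval p \o h =
    (fun x => \sum_(m <- msupp p) p@_m * \prod_i xi i (h x) ^+ m i).
  by apply/funext => x; rewrite /= /peval mevalE.
apply: polyfun_sum => m; apply: polyfunM (polyfun_cst _) _.
apply: polyfun_prod => i; elim: (m i) => [|k IHk]; first exact: polyfun_cst.
under eq_fun do rewrite exprS.
by apply: polyfunM => //; apply: (polyfun_linear (xi i \o h)).
Qed.

Lemma open_polyfun_neq0 f :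
  polyfun f -> open ([set x | f x != 0] : set (zariski E)).
Proof.
move=> [p ->]; rewrite -(setCK [set _ | _]) openC; apply/zariski_closedE.
exists [set p]; apply/seteqP; split => x /=.
  by move=> /negP; rewrite negbK => /eqP px q ->.
by move=> /(_ p erefl) ->; rewrite eqxx.
Qed.

(* The coefficients are indexed by noncommutative monomials. *)
Definition form d (c : {ffun {ffun 'I_d -> 'I_N} -> F^o}) (x : E) : F :=
  \sum_I c I * \prod_k xi (I k) x.

Lemma formD d (c c' : {ffun {ffun 'I_d -> 'I_N} -> F^o}) x :
  form (c + c') x = form c x + form c' x.
Proof.
by rewrite /form -big_split; apply: eq_bigr => I _; rewrite ffunE mulrDl.
Qed.

Lemma formZ d a (c : {ffun {ffun 'I_d -> 'I_N} -> F^o}) x :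
  form (a *: c) x = a * form c x.
Proof.
by rewrite /form big_distrr; apply: eq_bigr => I _; rewrite ffunE -mulrA.
Qed.

Lemma polyfun_form d (c : {ffun {ffun 'I_d -> 'I_N} -> F^o}) :
  polyfun (form c).
Proof.
apply: polyfun_sum => I; apply: polyfunM (polyfun_cst _) _.
by apply: polyfun_prod => k; apply: polyfun_coord.
Qed.

(** After distributing, a choice of one coordinate per factor is exactly one index [I], so no like
    terms have to be collected. Linear substitutions and determinants are both special cases. *)
Lemma form_sum_prod d (J : finType) (w : J -> F)
    (l : J -> 'I_d -> {linear E -> F^o}) :
  exists c : {ffun {ffun 'I_d -> 'I_N} -> F^o},
    forall x, form c x = \sum_j w j * \prod_k l j k x.
Proof.
pose a j k (i : 'I_N) := l j k (vbasis {:E})`_i.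
exists [ffun I : {ffun 'I_d -> 'I_N} => \sum_j w j * \prod_k a j k (I k)] => x.
transitivity (\sum_j w j * \prod_k \sum_i a j k i * xi i x); last first.
  apply: eq_bigr => j _; congr (_ * _); apply: eq_bigr => k _.
  rewrite [in RHS](coord_vbasis (memvf x)) linear_sum.
  by apply: eq_bigr => i _; rewrite linearZ mulrC.
under [RHS]eq_bigr do rewrite bigA_distr_bigA big_distrr /=.
rewrite exchange_big /form; apply: eq_bigr => I _.
rewrite ffunE big_distrl /=; apply: eq_bigr => j _.
by rewrite big_split mulrA.
Qed.

Lemma form_comp d (c : {ffun {ffun 'I_d -> 'I_N} -> F^o})
    (h : {linear E -> E}) :
  exists c' : {ffun {ffun 'I_d -> 'I_N} -> F^o},
    forall x, form c' x = form c (h x).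
Proof.
exact: (form_sum_prod c (fun (I : {ffun 'I_d -> 'I_N}) k => xi (I k) \o h)).
Qed.

Lemma form_det r (l : 'I_r -> 'I_r -> {linear E -> F^o}) :
  exists c : {ffun {ffun 'I_r -> 'I_N} -> F^o},
    forall x, form c x = \det (\matrix_(i, j) l i j x).
Proof.
have [c cE] := form_sum_prod (fun s : 'S_r => (-1) ^+ s) (fun s i => l i (s i)).
exists c => x; rewrite cE; apply: eq_bigr => s _; congr (_ * _).
by apply: eq_bigr => i _; rewrite mxE.
Qed.

End PolynomialFunctions.

(** * Germs of forms on a connected homogeneous set *)

Section HomogeneousConnected.
Variables (F : fieldType) (E : vectType F) (G : set E) (d : nat).
Hypothesis Gconn : connected (G : set (zariski E)).
Hypothesis Ghom : forall x y, G x -> G y -> exists h h' : {linear E -> E},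
  [/\ h x = y, cancel h h', cancel h' h,
      forall z, G z -> G (h z) & forall z, G z -> G (h' z)].
Local Notation N := (\dim {:E}).
Local Notation coefs := {ffun {ffun 'I_d -> 'I_N} -> F^o}.

(** Principal open sets suffice as neighbourhoods: they form a base of the topology, and two of them
    are intersected by multiplying their equations. *)
Definition vanishes_near (x : E) (c : coefs) :=
  exists f, [/\ polyfun f, f x != 0 &
                forall y, G y -> f y != 0 -> form c y = 0].

Lemma vanishes_near_translate (h h' : {linear E -> E}) (c c' : coefs) x :
    cancel h' h -> (forall z, G z -> G (h' z)) ->
    (forall y, form c' y = form c (h y)) -> cancel h h' ->
    (forall z, G z -> G (h z)) ->
  vanishes_near (h x) c <-> vanishes_near x c'.
Proof.
move=> h'K Gh' c'E hK Gh; split=> -[f [pf fx0 f0]].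
  exists (f \o h); split=> //; first exact: polyfun_comp.
  by move=> y Gy fy; rewrite c'E; apply: f0 => //; apply: Gh.
exists (f \o h'); split; first exact: polyfun_comp.
  by rewrite /= hK.
by move=> y Gy fy; rewrite -[y]h'K -c'E; apply: f0 => //; apply: Gh'.
Qed.

Lemma vanishes_near_locally_constant_at x1 : G x1 ->
  exists x0 f0 (U : {vspace coefs}), [/\ G x0, polyfun f0, f0 x0 != 0 &
    forall y, G y -> f0 y != 0 -> forall c, vanishes_near y c <-> c \in U].
Proof.
move=> Gx1.
(* The maximum is taken over all points of G at once; the dimension of [coefs] bounds it. *)
pose P n := exists (U : {vspace coefs}) x,
  [/\ G x, forall c, c \in U -> vanishes_near x c & \dim U = n].
have P0 : exists n, `[< P n >].
  exists 0%N; apply/asboolP; exists 0%VS, x1; split; rewrite ?dimv0 // => c.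
  rewrite memv0 => /eqP ->; exists (fun=> 1); split; rewrite ?oner_eq0 //.
    exact: polyfun_cst.
  by move=> y _ _; rewrite -(scale0r 0) formZ mul0r.
have Ple n : `[< P n >] -> (n <= \dim {:coefs})%N.
  by move=> /asboolP[U [x [_ _ <-]]]; apply: dimvS; apply: subvf.
case: (ex_maxnP P0 Ple) => n /asboolP[U [x0 [Gx0 Ux0 dU]]] nmax.
have /choice[f fP] : forall i : 'I_(\dim U), exists f,
    [/\ polyfun f, f x0 != 0 &
      forall y, G y -> f y != 0 -> form (vbasis U)`_i y = 0].
  move=> i; apply: Ux0; apply: vbasis_mem; apply: mem_nth.
  by rewrite size_tuple.
(* A basis of [U] is finite, so the product of its witnesses defines one neighbourhood of [x0] on
   which all of [U] vanishes. *)
pose f0 y := \prod_i f i y.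
have pf0 : polyfun f0 by apply: polyfun_prod => i; case: (fP i).
have Uf0 c y : c \in U -> G y -> f0 y != 0 -> form c y = 0.
  move=> cU Gy /prodf_neq0 fy; rewrite (coord_vbasis cU).
  elim/big_rec: _ => [|i c' _ c'0]; first by rewrite -(scale0r 0) formZ mul0r.
  rewrite formD formZ c'0 addr0; case: (fP i) => _ _ -> //; last exact: fy.
  by rewrite mulr0.
exists x0, f0, U; split=> //; first by apply/prodf_neq0 => i _; case: (fP i).
move=> y Gy fy c; split=> [cy|cU]; last first.
  by exists f0; split=> // z; apply: Uf0.
(* A form [c] outside [U] vanishing near y would enlarge [U] at the point y, against maximality. *)
suff : (\dim (U + <[c]>) <= \dim U)%N.
  move=> le; have /eqP -> : U == (U + <[c]>)%VS by rewrite eqEdim addvSl.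
  exact: (subvP (addvSr U <[c]>)) (memv_line c).
rewrite dU; apply: nmax; apply/asboolP; exists (U + <[c]>)%VS, y; split=> //.
move=> _ /memv_addP[u uU [_ /vlineP[k ->] ->]].
case: cy => f' [pf' f'y f'0]; exists (fun z => f0 z * f' z); split.
- exact: polyfunM.
- by rewrite mulf_neq0.
move=> z Gz; rewrite mulf_eq0 negb_or => /andP[f0z f'z].
by rewrite formD formZ Uf0 // f'0 // mulr0 addr0.
Qed.

Lemma vanishes_near_locally_constant x : G x ->
  exists f, [/\ polyfun f, f x != 0 & forall y, G y -> f y != 0 ->
    vanishes_near y = vanishes_near x].
Proof.
move=> Gx; have [x0 [f0 [U [Gx0 pf0 f0x0 Uf0]]]] :=
  vanishes_near_locally_constant_at Gx.
have [h [h' [hx0 hK h'K Gh Gh']]] := Ghom Gx Gx0.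
exists (f0 \o h); split; rewrite /= ?hx0 //; first exact: polyfun_comp.
move=> y Gy fy; apply/funext => c; apply/propext.
(* Pulling [c] back by [h'] turns vanishing near z into vanishing near [h z], where [U] decides
   it. *)
have [c' c'E] := form_comp c h'.
have tr z : vanishes_near z c <-> vanishes_near (h z) c'.
  by have := vanishes_near_translate (h z) hK Gh c'E h'K Gh'; rewrite hK.
rewrite !tr Uf0 ?hx0 //; last exact: Gh.
by rewrite Uf0.
Qed.

Lemma form_eq0_of_open (c : coefs) f x :
    polyfun f -> G x -> f x != 0 ->
    (forall y, G y -> f y != 0 -> form c y = 0) ->
  forall y, G y -> form c y = 0.
Proof.
move=> pf Gx fx fc y Gy.
have /choice[g gP] : forall z, exists f, G z -> [/\ polyfun f, f z != 0 &
    forall y, G y -> f y != 0 -> vanishes_near y = vanishes_near z].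
  move=> z; case: (pselect (G z)) => [Gz|nGz]; last by exists (fun=> 0).
  by have [f' ?] := vanishes_near_locally_constant Gz; exists f'.
pose nbh (z : E) : set (zariski E) := [set t | g z t != 0].
pose B : set (zariski E) := [set z | G z /\ vanishes_near z = vanishes_near x].
have nbh_open (A : set (zariski E)) : A `<=` G -> open (\bigcup_(z in A) nbh z).
  move=> AG; apply: bigcup_open => z Az.
  by apply: open_polyfun_neq0; case: (gP z (AG z Az)).
(* Germs are constant on each [nbh z] within G. So B is relatively open, as the trace of the
   neighbourhoods of its points, and relatively closed, as the complement of those of the other
   points. *)
have BG : B = G.
  apply: Gconn; first by exists x.
    exists (\bigcup_(z in B) nbh z); first by apply: nbh_open => z [].
    apply/seteqP; split=> [z [Gz zx]|z [Gz [t [Gt tx] zt]]].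
      by split=> //; exists z => //; case: (gP z Gz).
    by split=> //; rewrite -tx; case: (gP t Gt) => _ _; apply.
  exists (~` \bigcup_(z in G `\` B) nbh z).
    by apply: open_closedC; apply: nbh_open => z [].
  apply/seteqP; split=> [z [Gz zx]|z [Gz nz]].
    split=> // -[t [Gt ntx] zt]; apply: ntx; split=> //; rewrite -zx.
    by case: (gP t Gt) => _ _ ->.
  apply: contrapT => nBz; apply: nz; exists z => //.
  by case: (gP z Gz).
have [_ yx] : B y by rewrite BG.
have : vanishes_near x c by exists f.
by rewrite -yx => -[f' [_ f'y]]; apply.
Qed.

End HomogeneousConnected.

(** * Minors controlling the dimension of an intersection *)

Section LinearFunctionalsOnHom.
Variables (F : fieldType) (vT : vectType F).

Definition postcomp (h g : 'End(vT)) : 'End(vT) := (h \o g)%VF.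

Lemma postcomp_linear h : linear (postcomp h).
Proof. by move=> a f g; rewrite /postcomp comp_lfunDr comp_lfunZr. Qed.

HB.instance Definition _ h := GRing.isLinear.Build F 'End(vT) 'End(vT) _
  (postcomp h) (postcomp_linear h).

Definition eval_at (u : vT) (g : 'End(vT)) : vT := g u.

Lemma eval_at_linear u : linear (eval_at u).
Proof. by move=> a f g; rewrite /eval_at add_lfunE scale_lfunE. Qed.

HB.instance Definition _ u := GRing.isLinear.Build F 'End(vT) vT _
  (eval_at u) (eval_at_linear u).

(* The form is a minor of g followed by a projection with kernel W. *)
Lemma dim_cap_le_form (V W : {vspace vT}) (g1 : 'End(vT)) :
  lker g1 == 0%VS ->
  exists d (c : {ffun {ffun 'I_d -> 'I_(\dim {:'End(vT)})} -> F^o}),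
    form c g1 != 0 /\
    forall g, lker g == 0%VS -> form c g != 0 ->
      (\dim (g @: V :&: W) <= \dim (g1 @: V :&: W))%N.
Proof.
move=> kg1; pose V0 := (g1 @: V :\: W)%VS; pose b := vbasis V0.
have V0W : (V0 :&: W = 0)%VS by apply: capv_diff.
pose pi := daddv_pi V0 W; pose v (i : 'I_(\dim V0)) := (g1^-1)%VF b`_i.
have bV0 (i : 'I_(\dim V0)) : b`_i \in V0.
  by apply: vbasis_mem; apply: mem_nth; rewrite size_tuple.
have vV i : v i \in V.
  have /memv_imgP[u uV bE] : b`_i \in (g1 @: V)%VS.
    by apply: subvP (bV0 i); apply: diffvSl.
  by rewrite /v bE lker0_lfunK.
have [c cE] := form_det (fun i j => coord b j \o (pi \o eval_at (v i))).
have dimV g : lker g == 0%VS -> \dim (g @: V) = \dim V.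
  by move=> /eqP kg; rewrite limg_dim_eq // kg capv0.
have piW u : u \in W -> pi u = 0.
  move=> uW; have := daddv_pi_add V0W (subvP (addvSr V0 W) _ uW).
  rewrite -/pi (daddv_pi_id _ uW) ?[(W :&: _)%VS]capvC //.
  by move/(canRL (addrK u)); rewrite subrr.
exists (\dim V0), c; split.
  (* At [g1] the vectors [g1 (v i)] are the basis of [V0] itself, so the minor is 1. *)
  rewrite cE (_ : \matrix_(_, _) _ = 1%:M) ?det1 ?oner_eq0 //.
  apply/matrixP => i j; rewrite !mxE /= /eval_at /v lker0_lfunVK //.
  rewrite /pi daddv_pi_id ?V0W // coord_free //.
  exact: (basis_free (vbasisP V0)).
move=> g kg; rewrite cE; set A := (X in \det X) => detA.
have Aunit : A \in unitmx by rewrite unitmxE unitfE.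
pose y := [tuple pi (g (v i)) | i < \dim V0].
have yE (i : 'I_(\dim V0)) : y`_i = pi (g (v i)).
  by rewrite -tnth_nth tnth_mktuple.
(* A linear relation among the [y] is a row vector killed by the invertible matrix [A]. *)
have yfree : free y.
  apply/freeP => k; under eq_bigr do rewrite yE; move=> ky0.
  have : (\row_i k i) *m A = 0.
    apply/rowP => j; rewrite !mxE -[RHS](linear0 (coord b j)) -ky0 linear_sum.
    by apply: eq_bigr => i _; rewrite linearZ !mxE.
  move=> /(congr1 (mulmx^~ (invmx A))); rewrite mulmxK // mul0mx => /rowP k0 i.
  by have := k0 i; rewrite !mxE.
have le_dim : (\dim V0 <= \dim (pi @: (g @: V)))%N.
  have /eqP <- : \dim <<y>> == \dim V0 by move: yfree; rewrite /free size_tuple.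
  apply: dimvS; apply/span_subvP => _ /mapP[i _ ->] /=.
  by rewrite !memv_img.
(* Rank-nullity for [pi] on the image of V: the rank is at least [\dim V0] and the kernel contains
   W. *)
have := limg_ker_dim pi (g @: V); have := dimv_cap_compl (g1 @: V) W.
have : (\dim (g @: V :&: W) <= \dim (g @: V :&: lker pi))%N.
  apply/dimvS/capvS => //; apply/subvP => u uW.
  by rewrite memv_ker piW.
move: le_dim; rewrite /V0 !dimV //; lia.
Qed.

End LinearFunctionalsOnHom.

(** * Generic intersection dimensions for a connected group *)

Section Groups.
Variables (F : fieldType) (vT : vectType F) (G : set 'End(vT)).
Hypothesis Ggrp : GL_subgroup G.
Hypothesis Gconn : zariski_connected G.

Let G1 : G \1%VF. Proof. by case: Ggrp. Qed.
Let GM g h : G g -> G h -> G (g \o h)%VF.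
Proof. by case: Ggrp => _ _ + _; apply. Qed.
Let GV g : G g -> G (g^-1)%VF. Proof. by case: Ggrp => _ _ _; apply. Qed.
Let Gker g : G g -> lker g == 0%VS. Proof. by case: Ggrp => + _ _ _; apply. Qed.

Lemma left_translation_transitive x y : G x -> G y ->
  exists h h' : {linear 'End(vT) -> 'End(vT)},
  [/\ h x = y, cancel h h', cancel h' h,
      forall z, G z -> G (h z) & forall z, G z -> G (h' z)].
Proof.
move=> Gx Gy; have := Gker Gx; have := Gker Gy => ky kx.
exists (postcomp (y \o x^-1)), (postcomp (x \o y^-1)).
rewrite /= /postcomp; split=> [|z|z|z Gz|z Gz]; rewrite -?comp_lfunA.
- by rewrite lker0_compVf ?comp_lfun1r.
- by rewrite lker0_compKf ?lker0_compVKf.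
- by rewrite lker0_compKf ?lker0_compVKf.
- by apply: GM => //; apply: GM => //; apply: GV.
- by apply: GM => //; apply: GM => //; apply: GV.
Qed.

(** The minor for [g1] is nonzero on a nonempty open part of G. Were the minor for [g2] zero there,
    it would vanish on all of G, in particular at [g2]. *)
Lemma simultaneously_generic (V W V' W' : {vspace vT}) g1 g2 : G g1 -> G g2 ->
  exists2 g, G g & (\dim (g @: V :&: W) <= \dim (g1 @: V :&: W))%N /\
                   (\dim (g @: V' :&: W') <= \dim (g2 @: V' :&: W'))%N.
Proof.
move=> Gg1 Gg2.
have [d1 [c1 [c1g1 c1P]]] := dim_cap_le_form V W (Gker Gg1).
have [d2 [c2 [c2g2 c2P]]] := dim_cap_le_form V' W' (Gker Gg2).
apply: contrapT => ng; move/eqP: c2g2; apply.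
apply: (form_eq0_of_open Gconn left_translation_transitive (polyfun_form c1)
  Gg1) => // y Gy c1y; apply: contrapT => /eqP c2y; apply: ng; exists y => //.
by split; [apply: c1P|apply: c2P]; rewrite ?Gker.
Qed.

(** The set of dimensions is nonempty because G contains the identity, so the minimum exists and
    [xget] does not fall back on 0. *)
Definition generic_dim (V W : {vspace vT}) : nat :=
  xget 0%N (is_min [set (\dim (g @: V :&: W))%N | g in G]).

Lemma generic_dim_min V W :
  is_min [set (\dim (g @: V :&: W))%N | g in G] (generic_dim V W).
Proof.
apply: xgetPex.
pose P n := `[< [set (\dim (g @: V :&: W))%N | g in G] n >].
have exP : exists n, P n.
  by exists (\dim (\1 @: V :&: W)); apply/asboolP; exists \1%VF.
case: (ex_minnP exP) => n /asboolP Pn nmin; exists n; split=> // k Pk.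
by apply: nmin; apply/asboolP.
Qed.

Lemma generic_dim_le V W g : G g -> (generic_dim V W <= \dim (g @: V :&: W))%N.
Proof. by move=> Gg; case: (generic_dim_min V W) => _; apply; exists g. Qed.

Lemma generic_dim_attained V W :
  exists2 g, G g & \dim (g @: V :&: W) = generic_dim V W.
Proof. by case: (generic_dim_min V W) => -[g]; exists g. Qed.

(** Applying g to the intersection of [g^-1 @: W] with V gives that of W with [g @: V]. *)
Lemma generic_dim_sym_le V W : (generic_dim W V <= generic_dim V W)%N.
Proof.
have [g Gg <-] := generic_dim_attained V W.
apply: leq_trans (generic_dim_le W V (GV Gg)) _.
rewrite -(limg_dim_eq (f := g) (U := g^-1 @: W :&: V)); last first.
  by rewrite (eqP (Gker Gg)) capv0.
rewrite lker0_img_cap ?Gker // -limg_comp lker0_compfV ?Gker // lim1g.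
by rewrite capvC.
Qed.

Lemma generic_dim_sym V W : generic_dim V W = generic_dim W V.
Proof. by apply/eqP; rewrite eqn_leq !generic_dim_sym_le. Qed.

Lemma generic_dim_img V W g :
  G g -> (generic_dim V (g @: W) <= generic_dim V W)%N.
Proof.
move=> Gg; have [h Gh <-] := generic_dim_attained V W.
apply: leq_trans (generic_dim_le _ _ (GM Gg Gh)) _.
rewrite limg_comp -lker0_img_cap ?Gker // limg_dim_eq //.
by rewrite (eqP (Gker Gg)) capv0.
Qed.

Lemma generic_dim_supermodular V W1 W2 :
  (generic_dim V W1 + generic_dim V W2 <=
   generic_dim V (W1 + W2) + generic_dim V (W1 :&: W2))%N.
Proof.
have [g1 Gg1 <-] := generic_dim_attained V (W1 + W2).
have [g2 Gg2 <-] := generic_dim_attained V (W1 :&: W2).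
have [g Gg [le1 le2]] :=
  simultaneously_generic V (W1 + W2) V (W1 :&: W2) Gg1 Gg2.
(* For this single g, the intersections of [g @: V] with [W1] and [W2] have their sum inside
   [W1 + W2] and their intersection inside [W1 :&: W2]. *)
apply: leq_trans (leq_add le1 le2).
apply: leq_trans (leq_add (generic_dim_le V W1 Gg) (generic_dim_le V W2 Gg)) _.
rewrite -dimv_sum_cap leq_add //; apply: dimvS.
  by rewrite subv_cap subv_add !capvSl addvS ?capvSr.
rewrite !subv_cap; apply/and3P; split.
- by apply: subv_trans (capvSl _ _) (capvSl _ _).
- by apply: subv_trans (capvSl _ _) (capvSr _ _).
- by apply: subv_trans (capvSr _ _) (capvSr _ _).
Qed.

Lemma dim_img g U : G g -> \dim (g @: U) = \dim U.
Proof. by move=> /Gker/eqP kg; rewrite limg_dim_eq // kg capv0. Qed.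

(** * Excess over the expected dimension, and irreducibility *)

Hypothesis Girr : acts_irreducibly_on G.
Local Notation n := (\dim {:vT}).

(** This is n times the generic dimension minus [\dim V * \dim W], shifted by [n * \dim V] to stay
    in nat; the subtraction is exact as [\dim W <= n]. The expected dimension corresponds to the
    value [n * \dim V]. *)
Definition excess V W := (n * generic_dim V W + \dim V * (n - \dim W))%N.

Lemma excess_supermodular V W1 W2 :
  (excess V W1 + excess V W2 <= excess V (W1 + W2) + excess V (W1 :&: W2))%N.
Proof.
have := generic_dim_supermodular V W1 W2; have := dimv_sum_cap W1 W2.
have := dimvS (subvf W1); have := dimvS (subvf W2).
have := dimvS (subvf (W1 + W2)).
have := dimvS (subvf (W1 :&: W2)); rewrite /excess; nia.
Qed.

Lemma excess_img V W g : G g -> excess V (g @: W) = excess V W.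
Proof.
move=> Gg; rewrite /excess dim_img //; congr (n * _ + _)%N; apply/eqP.
rewrite eqn_leq generic_dim_img //=.
have := generic_dim_img V (g @: W) (GV Gg).
by rewrite -limg_comp lker0_compVf ?Gker // lim1g.
Qed.

Lemma excess_le V W : (excess V W <= n * \dim V)%N.
Proof.
(* Since dimensions are below [n.+1], this number orders subspaces lexicographically: first by
   excess, then by dimension. *)
pose P k := `[< exists U, (excess V U * n.+1 + \dim U)%N = k >].
have exP : exists k, P k by eexists; apply/asboolP; exists W.
have Ple k : P k -> (k <= (n * n + n * n) * n.+1 + n)%N.
  move=> /asboolP[U <-]; rewrite leq_add ?dimvS ?subvf // leq_mul //.
  rewrite leq_add // leq_mul ?leq_subr ?dimvS ?subvf //.
  by apply: leq_trans (generic_dim_le V U G1) _; rewrite dimvS ?subvf.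
case: (ex_maxnP exP Ple) => k /asboolP[U kE] kmax.
have {k kE kmax} Umax U' : (excess V U' * n.+1 + \dim U' <=
                            excess V U * n.+1 + \dim U)%N.
  by rewrite kE; apply: kmax; apply/asboolP; exists U'.
have le_excess U' : (excess V U' <= excess V U)%N.
  have := Umax U'; have := dimvS (subvf U'); have := dimvS (subvf U); nia.
have Ustab g : G g -> (g @: U <= U)%VS.
  (* Both U and its translate have maximal excess, hence so does their sum by supermodularity; the
     tie-break on dimension then forces the sum to be U. *)
  move=> Gg; have := excess_supermodular V (g @: U) U; rewrite excess_img //.
  have := le_excess (g @: U :&: U)%VS => le1 le2.
  have le3 : (\dim (g @: U + U) <= \dim U)%N.
    by have := Umax (g @: U + U)%VS; nia.
  have /eqP UE : U == (g @: U + U)%VS by rewrite eqEdim addvSr.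
  rewrite [X in (_ <= X)%VS]UE.
  exact: addvSl.
apply: leq_trans (le_excess W) _.
case: Girr => _ /(_ U Ustab) [->|->]; rewrite /excess.
  have := generic_dim_le V 0%VS G1; rewrite capv0 dimv0; nia.
have := generic_dim_le V fullv G1; rewrite capvf lim1g; nia.
Qed.

(** Subspaces whose excess reaches the bound [n * \dim V] form a G-invariant sublattice:
    supermodularity squeezes sums and intersections against that bound. It contains W, hence the
    lattice W generates. *)
Lemma generic_dim_lattice V W W' :
    (n * generic_dim V W = \dim V * \dim W)%N -> inv_sublattice_gen G W W' ->
  (n * generic_dim V W' = \dim V * \dim W')%N.
Proof.
have excessE U : (n * generic_dim V U = \dim V * \dim U)%N <->
                 excess V U = (n * \dim V)%N.
  by rewrite /excess; have := dimvS (subvf U); split; nia.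
rewrite excessE => VW /(_ [set U | excess V U = (n * \dim V)%N]) LW.
apply/excessE; apply: LW; split; last by move=> _ ->.
have le_excess := excess_le V.
split; last by move=> g U Gg; rewrite /= excess_img.
split=> [||U U' /= EU EU'|U U' /= EU EU'].
- apply/excessE; have := generic_dim_le V 0%VS G1; rewrite capv0 dimv0; nia.
- apply/excessE; have [g Gg <-] := generic_dim_attained V fullv.
  by rewrite capvf dim_img // mulnC.
- have := excess_supermodular V U U'; have := le_excess (U + U')%VS.
  have := le_excess (U :&: U')%VS; lia.
- have := excess_supermodular V U U'; have := le_excess (U + U')%VS.
  have := le_excess (U :&: U')%VS; lia.
Qed.

(** * Generated lattices and complements *)

Lemma inv_sublattice_genP W :
  is_sublattice (inv_sublattice_gen G W) /\
  is_invariant G (inv_sublattice_gen G W).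
Proof.
split; first split.
- by move=> L [[[]]].
- by move=> L [[[]]].
- by move=> U U' LU LU' L /[dup] LP [[[_ _ LD _] _] _];
  apply: LD; [apply: LU|apply: LU'].
- by move=> U U' LU LU' L /[dup] LP [[[_ _ _ LI] _] _];
  apply: LI; [apply: LU|apply: LU'].
- by move=> g U Gg LU L /[dup] LP [[_ Linv] _]; apply: Linv => //; apply: LU.
Qed.

(* The translates of an atom A span, so a maximal U' meeting U trivially is a
   complement: a translate of A not inside U + U' could be added to U'. *)
Lemma invariant_sublattice_complemented (L : set {vspace vT}) :
  is_sublattice L -> is_invariant G L -> complemented L.
Proof.
move=> [L0 LT LD LI] Linv U LU.
pose P k := `[< exists A, [/\ L A, A <> 0%VS & \dim A = k] >].
have exP : exists k, P k.
  by exists n; apply/asboolP; exists fullv; split=> //; apply/eqP; case: Girr.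
case: (ex_minnP exP) => a /asboolP[A [LA An0 dA]] amin.
pose Q k := `[< exists U', [/\ L U', (U :&: U' = 0)%VS & \dim U' = k] >].
have exQ : exists k, Q k.
  by exists 0%N; apply/asboolP; exists 0%VS; rewrite capv0 dimv0.
have Qle k : Q k -> (k <= n)%N.
  by move=> /asboolP[U' [_ _ <-]]; apply/dimvS/subvf.
case: (ex_maxnP exQ Qle) => k /asboolP[U' [LU' UU' dU']] kmax.
exists U' => //; suff UU'T : (U + U' = fullv)%VS.
  by split; rewrite ?UU'T //; apply/directv_addP.
have Asub g : G g -> (g @: A <= U + U')%VS.
  (* By minimality of [a], B is zero or the whole translate. If it is zero, adding the translate to
     [U'] keeps the intersection with U trivial, so maximality of [U'] absorbs it. *)
  move=> Gg; set B := (g @: A :&: (U + U'))%VS.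
  have LB : L B by apply: LI; [apply: Linv|apply: LD].
  have [B0|Bn0] := pselect (B = 0%VS); last first.
    have /amin le_aB : P (\dim B) by apply/asboolP; exists B.
    have /eqP <- : B == (g @: A)%VS.
      by rewrite eqEdim capvSl dim_img // dA.
    exact: capvSr.
  have capUA : (U :&: (U' + g @: A) = 0)%VS.
    apply/eqP; rewrite -subv0; apply/subvP => u /memv_capP[uU].
    move=> /memv_addP[u' u'U' [w wA uE]].
    have wB : w \in B.
      rewrite memv_cap wA /= -[w](addKr u') -uE addrC.
      by rewrite memv_add // memvN.
    move: wB; rewrite B0 memv0 => /eqP w0; move: uE; rewrite w0 addr0 => uu'.
    by rewrite -UU' memv_cap uU uu'.
  have /kmax : Q (\dim (U' + g @: A)).
    apply/asboolP; exists (U' + g @: A)%VS; split=> //.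
    by apply: LD => //; apply: Linv.
  rewrite -dU' => le; have /eqP -> : (U + U' == U + (U' + g @: A))%VS.
    rewrite (_ : U' + g @: A = U')%VS //.
    by apply/eqP; rewrite eq_sym eqEdim addvSl.
  by rewrite addvA addvSr.
(* The span of the translates of A is replaced by the largest C all of whose translates lie in
   [U + U']: it is G-stable and contains A, so it is the full space. *)
pose S k := `[< exists2 C : {vspace vT},
  forall g, G g -> (g @: C <= U + U')%VS & \dim C = k >].
have exS : exists k, S k.
  by exists (\dim A); apply/asboolP; exists A.
have Sle j : S j -> (j <= n)%N.
  by move=> /asboolP[C _ <-]; apply/dimvS/subvf.
case: (ex_maxnP exS Sle) => j /asboolP[C gCU dC] jmax.
have leCj C' : (forall g, G g -> (g @: C' <= U + U')%VS) -> (C' <= C)%VS.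
  move=> gC'U.
  have /jmax : S (\dim (C + C')).
    apply/asboolP; exists (C + C')%VS => // g Gg.
    by rewrite limgD subv_add gCU // gC'U.
  rewrite -dC => le; have /eqP -> : C == (C + C')%VS by rewrite eqEdim addvSl.
  exact: addvSr.
case: Girr => _ /(_ C) [|C0|CT].
- move=> g Gg; apply: leCj => h Gh; rewrite -limg_comp; apply: gCU.
  exact: GM.
- by case: An0; apply/eqP; rewrite -subv0 -C0; apply: leCj.
- by apply/eqP; rewrite eqEsubv subvf -CT -[C]lim1g gCU.
Qed.

End Groups.

(** * The dimension formula and compatible splittings *)

Theorem theorem5p5 (F : fieldType) (vT : vectType F) (G : set 'End(vT))
    (V W : {vspace vT}) (m : nat) :
  GL_subgroup G ->
  zariski_connected G ->
  acts_irreducibly_on G ->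
  is_min [set (\dim (g @: V :&: W))%N | g in G] m ->
  m%:R = (\dim V)%:R * (\dim W)%:R / (\dim {:vT})%:R :> rat ->
  (forall V' W' : {vspace vT},
     inv_sublattice_gen G V V' -> inv_sublattice_gen G W W' ->
     (\dim (V' :&: W'))%:R
       = (\dim V')%:R * (\dim W')%:R / (\dim {:vT})%:R :> rat)
  /\ complemented (inv_sublattice_gen G W)
  /\ (forall W' W'' : {vspace vT},
        inv_sublattice_gen G W W' -> inv_sublattice_gen G W W'' ->
        is_dsum {:vT} W' W'' ->
        forall V' : {vspace vT}, inv_sublattice_gen G V V' ->
          is_dsum V' (V' :&: W') (V' :&: W'')).
Proof.
move=> Ggrp Gconn Girr [[g0 Gg0 mE] mmin] mVW.
have n_gt0 : (0 < \dim {:vT})%N by rewrite lt0n dimv_eq0; case: Girr.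
have ratE (k a b : nat) : (k%:R = a%:R * b%:R / (\dim {:vT})%:R :> rat) <->
                  (\dim {:vT} * k = a * b)%N.
  have nn0 : (\dim {:vT})%:R != 0 :> rat by rewrite pnatr_eq0 -lt0n.
  split=> [/(canLR (divfK nn0))|E].
    by rewrite -!natrM => /eqP; rewrite eqr_nat mulnC => /eqP.
  by apply: (canRL (mulfK nn0)); rewrite -!natrM mulnC E.
have gVW : generic_dim G V W = m.
  apply/eqP; rewrite eqn_leq -{1}mE generic_dim_le //=; apply: mmin.
  by have [g Gg <-] := generic_dim_attained Ggrp V W; exists g.
move: mVW => /ratE; rewrite -gVW => VW.
(* Equality passes from W to [W'] with V fixed, then, by symmetry, from V to [V'] with [W'] fixed.
   The identity of G bounds the generic dimension by the actual one. *)
have generic V' W' : inv_sublattice_gen G V V' -> inv_sublattice_gen G W W' ->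
    (\dim V' * \dim W' <= \dim {:vT} * \dim (V' :&: W'))%N.
  move=> LV' LW'; have VW' := generic_dim_lattice Ggrp Gconn Girr VW LW'.
  have W'V : (\dim {:vT} * generic_dim G W' V = \dim W' * \dim V)%N.
    by rewrite generic_dim_sym // VW' mulnC.
  have := generic_dim_lattice Ggrp Gconn Girr W'V LV'.
  rewrite generic_dim_sym // [leqLHS]mulnC => <-.
  rewrite leq_mul2l; apply/orP; right.
  have [_ G1 _ _] := Ggrp.
  by apply: leq_trans (generic_dim_le Ggrp V' W' G1) _; rewrite lim1g.
have [Wlat Winv] := inv_sublattice_genP G W.
have Wcompl := invariant_sublattice_complemented Ggrp Girr Wlat Winv.
have split_dims V' W' W'' : inv_sublattice_gen G V V' ->
    inv_sublattice_gen G W W' -> inv_sublattice_gen G W W'' ->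
    is_dsum {:vT} W' W'' ->
    (\dim {:vT} * \dim (V' :&: W') = \dim V' * \dim W')%N /\
    is_dsum V' (V' :&: W') (V' :&: W'').
  move=> LV' LW' LW'' [HE /directv_addP W'W''].
  have cap0 : (V' :&: W' :&: (V' :&: W'') = 0)%VS.
    by apply/eqP; rewrite -subv0 -W'W'' capvS ?capvSr.
  have dimH : (\dim W' + \dim W'' = \dim {:vT})%N.
    by rewrite [in RHS]HE dimv_disjoint_sum.
  have dimS : \dim (V' :&: W' + V' :&: W'') =
      (\dim (V' :&: W') + \dim (V' :&: W''))%N.
    exact: dimv_disjoint_sum.
  have sub : (V' :&: W' + V' :&: W'' <= V')%VS by rewrite subv_add !capvSl.
  have := dimvS sub; have := generic _ _ LV' LW'; have := generic _ _ LV' LW''.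
  (* The two lower bounds add up to [\dim {:vT} * \dim V'], while the direct sum lies in [V']; hence
     all three inequalities are equalities. *)
  move=> le1 le2 le3; split; first nia.
  split; last exact/directv_addP.
  by apply/eqP; rewrite eq_sym eqEdim sub; nia.
split; [|split] => //.
  move=> V' W' LV' LW'; apply/ratE.
  (* The exact formula for [W'] needs a partner in the lattice, supplied by complementation. *)
  have [W'' LW'' HE] := Wcompl _ LW'.
  by case: (split_dims _ _ _ LV' LW' LW'' HE).
move=> W' W'' LW' LW'' HE V' LV'.
by case: (split_dims _ _ _ LV' LW' LW'' HE).
Qed.
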